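(* Let $0<\mu<L$ and $N\ge1$. Consider a causal two-term one-gradient recurrence with real coefficients, initialized by $x_1=x_0-\gamma_0\nabla f(x_0)$ and, for $1\le t\le N-1$, evolved by $x_{t+1}=a_tx_t+b_tx_{t-1}-\gamma_t\nabla f(x_t)$. Assume that, on every scalar quadratic objective with curvature $\lambda\in[\mu,L]$, its residual polynomials are prefix-exact Chebyshev: $r_t(\lambda)=p_t^\star(\lambda)$ for $0\le t\le N$. Then its first-order Hessian-drift gain satisfies $$A_N\ge\frac{\epsilon_N^\star}{\Delta}\Bigl(4N^2+16\sum_{m=1}^{N-1}m^2\Bigr)^{1/2}.$$ Equality is attained by the standard prefix-exact Chebyshev recurrence. Consequently this recurrence is optimal (has the smallest $A_N$) inside the causal two-term prefix-exact class, and, as $N\to\infty$ with $\mu,L$ fixed, $$A_N\ge\frac{4}{\sqrt3}\,\frac{N^{3/2}}{\Delta}\,\epsilon_N^\star\,(1-o(1)).$$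
   Context: $T_k$ is the Chebyshev polynomial of the first kind. Put $\Delta=L-\mu$, $\eta=\frac{L+\mu}{L-\mu}>1$, $z(\lambda)=\eta-\frac{2\lambda}{\Delta}$, $p_t^\star(\lambda)=T_t(z(\lambda))/T_t(\eta)$, $\epsilon_N^\star=1/|T_N(\eta)|$, and $\beta_t=\frac{T_{t-1}(\eta)}{T_{t+1}(\eta)}$ for $t\ge1$. Residual polynomials: on the scalar objective $f(x)=\frac12\lambda x^2$ the iterates satisfy $x_t=r_t(\lambda)x_0$, which defines $r_t$. The standard prefix-exact Chebyshev recurrence is $x_1=x_0-\frac{2}{L+\mu}\nabla f(x_0)$ and, for $1\le t\le N-1$, $x_{t+1}=x_t+\beta_t(x_t-x_{t-1})-(1+\beta_t)\frac{2}{L+\mu}\nabla f(x_t)$. First-variation kernel and gain of a two-term recurrence: set $a_0=1$, $b_0=0$, $e_1=(1,0)^\top\in\mathbb R^2$, and $$C_t(\lambda)=\begin{pmatrix}a_t-\gamma_t\lambda & b_t\\ 1&0\end{pmatrix},\qquad 0\le t\le N-1.$$ Then $$K_s(\lambda,\nu)=-\,\gamma_s\; e_1^\top C_{N-1}(\lambda)\cdots C_{s+1}(\lambda)\,e_1\; e_1^\top C_{s-1}(\nu)\cdots C_0(\nu)\,e_1,\qquad 0\le s\le N-1,$$ with empty products equal to the identity, and $$A_N=\sup_{\lambda,\nu\in[\mu,L]}\Bigl(\sum_{s=0}^{N-1}|K_s(\lambda,\nu)|^2\Bigr)^{1/2}.$$ *)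

(* Defs.v *)
From HB Require Import structures.
From mathcomp Require Import all_boot all_order all_algebra.
From mathcomp Require Import all_classical all_reals all_analysis.
From mathcomp Require Import ring.

Set Implicit Arguments.
Unset Strict Implicit.
Unset Printing Implicit Defensive.

Import Order.TTheory GRing.Theory Num.Theory.
Import numFieldNormedType.Exports.

Local Open Scope ring_scope.

Fixpoint chebT (R : nzRingType) (k : nat) : {poly R} :=
  if k is k1.+1 then
    if k1 is k2.+1 then 2 *: ('X * chebT R k1) - chebT R k2 else 'X
  else 1.

Section Chebyshev.
Variables (R : realType) (mu L : R).

Definition eta : R := (L + mu) / (L - mu).

Definition zmap (lam : R) : R := eta - 2 * lam / (L - mu).

Definition pstar (t : nat) (lam : R) : R :=
  (chebT R t).[zmap lam] / (chebT R t).[eta].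

Definition eps_star (N : nat) : R := 1 / `|(chebT R N).[eta]|.

(* The momentum coefficient is only meant for t >= 1.  The value 0 at t = 0
   makes the general step of the Chebyshev recurrence coincide with its
   initialization x_1 = x_0 - 2 / (L + mu) * f'(x_0). *)
Definition beta (t : nat) : R :=
  if t is t'.+1 then (chebT R t').[eta] / (chebT R t'.+2).[eta] else 0.

End Chebyshev.

(* Coefficients of a causal two-term one-gradient recurrence.  The sequences
   are total, but a run of length N only uses the indices 0, ..., N - 1. *)
Record two_term (R : realType) := TwoTerm {
  coef_a : nat -> R;
  coef_b : nat -> R;
  coef_g : nat -> R;
  coef_a0 : coef_a 0%N = 1;
  coef_b0 : coef_b 0%N = 0
}.

Section Recurrence.
Variables (R : realType) (N : nat) (c : two_term R).

Definition trajectory (f : R -> R) (x : nat -> R) : Prop :=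
  x 1%N = x 0%N - coef_g c 0 * derive1 f (x 0%N) /\
  forall t, (1 <= t <= N.-1)%N ->
    x t.+1 = coef_a c t * x t + coef_b c t * x t.-1
             - coef_g c t * derive1 f (x t).

Definition quad (lam : R) (x : R) : R := 2^-1 * lam * x ^+ 2.

(* This determines the polynomials r 0, ..., r N uniquely. *)
Definition residual_polys (r : nat -> {poly R}) : Prop :=
  forall (lam : R) (x : nat -> R), trajectory (quad lam) x ->
    forall t, (t <= N)%N -> x t = (r t).[lam] * x 0%N.

Definition prefix_exact (mu L : R) : Prop :=
  exists2 r : nat -> {poly R}, residual_polys r &
    forall t, (t <= N)%N -> forall lam, mu <= lam <= L ->
      (r t).[lam] = pstar mu L t lam.

Definition companion (lam : R) (t : nat) : 'M[R]_2 :=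
  \matrix_(i, j)
    if i == 0 then (if j == 0 then coef_a c t - coef_g c t * lam
                    else coef_b c t)
    else (if j == 0 then 1 else 0).

Definition e1 : 'cV[R]_2 := delta_mx 0 0.

(* Ordered product C_(n-1) ... C_m, with the largest index on the left. *)
Definition companion_prod (lam : R) (m n : nat) : 'M[R]_2 :=
  \prod_(t <- rev (index_iota m n)) companion lam t.

Definition kernel (s : nat) (lam nu : R) : R :=
  - coef_g c s
  * (e1^T *m companion_prod lam s.+1 N *m e1) 0 0
  * (e1^T *m companion_prod nu 0 s *m e1) 0 0.

(* The supremum is that of a nonempty bounded set: the kernels are polynomial
   in (lam, nu), which ranges over a compact square. *)
Definition gain (mu L : R) : R :=
  sup [set Num.sqrt (\sum_(s < N) `|kernel s p.1 p.2| ^+ 2)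
      | p in [set p : R * R | mu <= p.1 <= L /\ mu <= p.2 <= L]]%classic.

End Recurrence.

Section StandardChebyshev.
Variables (R : realType) (mu L : R).

Definition cheb_rec : two_term R :=
  @TwoTerm R (fun t => 1 + beta mu L t) (fun t => - beta mu L t)
    (fun t => (1 + beta mu L t) * (2 / (L + mu))) (addr0 1) (oppr0 R).

Lemma cheb_rec_trajectoryP (N : nat) (f : R -> R) (x : nat -> R) :
  trajectory N cheb_rec f x <->
  x 1%N = x 0%N - 2 / (L + mu) * derive1 f (x 0%N) /\
  forall t, (1 <= t <= N.-1)%N ->
    x t.+1 = x t + beta mu L t * (x t - x t.-1)
             - (1 + beta mu L t) * (2 / (L + mu)) * derive1 f (x t).
Proof.
rewrite /trajectory /= addr0 mul1r.
by split=> -[-> h]; split=> // t /h ->; ring.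
Qed.

End StandardChebyshev.

(* Main.v *)
Require Import Defs.
From mathcomp Require Import all_boot all_order all_algebra.
From mathcomp Require Import all_classical all_reals all_analysis.
From mathcomp Require Import ring lra zify.
Import Order.TTheory GRing.Theory Num.Theory.
Import numFieldNormedType.Exports.

Set Implicit Arguments.
Unset Strict Implicit.
Unset Printing Implicit Defensive.

Local Open Scope classical_set_scope.
Local Open Scope ring_scope.

(** A polynomial vanishing on [-1, 1] is zero, so the identity expressing
    p*_(t+1) through p*_t and p*_(t-1) on [mu, L] determines a_t, b_t and
    gamma_t: for t < N every prefix-exact recurrence has the coefficients of
    the standard Chebyshev recurrence.  With z = zmap, its kernels are
      K_s(lam, nu) = - w_s / (L - mu) * U_(N-1-s)(z lam) * T_s(z nu) / T_N(eta),
    where w_0 = 2 and w_s = 4 for s >= 1.  Since |T_s| <= 1 and |U_m| <= m + 1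
    on [-1, 1], with equality at 1 = z mu, all the |K_s| are maximal together
    at lam = nu = mu, which gives the exact value of the gain. *)

(** * Chebyshev polynomials of both kinds: identities, bounds, independence *)

Fixpoint chebU (R : nzRingType) (k : nat) : {poly R} :=
  if k is k1.+1 then
    if k1 is k2.+1 then 2 *: ('X * chebU R k1) - chebU R k2 else 2 *: 'X
  else 1.

Lemma nat_ind2 (P : nat -> Prop) :
  P 0%N -> P 1%N -> (forall n, P n -> P n.+1 -> P n.+2) -> forall n, P n.
Proof.
move=> P0 P1 PS n; suff [] : P n /\ P n.+1 by [].
by elim: n => [//|n [Pn Pn1]]; split=> //; apply: PS.
Qed.

Section ChebyshevValues.
Variable R : realFieldType.
Implicit Types x : R.

Lemma chebT_rec x n :
  (chebT R n.+2).[x] = 2 * x * (chebT R n.+1).[x] - (chebT R n).[x].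
Proof.
have -> : chebT R n.+2 = 2 *: ('X * chebT R n.+1) - chebT R n by [].
by rewrite !(hornerD, hornerN, hornerZ, hornerM, hornerX) mulrA.
Qed.

Lemma chebU_rec x n :
  (chebU R n.+2).[x] = 2 * x * (chebU R n.+1).[x] - (chebU R n).[x].
Proof.
have -> : chebU R n.+2 = 2 *: ('X * chebU R n.+1) - chebU R n by [].
by rewrite !(hornerD, hornerN, hornerZ, hornerM, hornerX) mulrA.
Qed.

Lemma chebT0 x : (chebT R 0).[x] = 1. Proof. by rewrite /= !hornerE. Qed.
Lemma chebT1 x : (chebT R 1).[x] = x. Proof. by rewrite /= !hornerE. Qed.
Lemma chebU0 x : (chebU R 0).[x] = 1. Proof. by rewrite /= !hornerE. Qed.
Lemma chebU1 x : (chebU R 1).[x] = 2 * x. Proof. by rewrite /= !hornerE. Qed.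

Definition chebE := (chebT_rec, chebU_rec, chebT1, chebU1, chebT0, chebU0).

(** With [x = cos a] and [U_n(x) = sin((n+1)a) / sin a], this is the addition formula for
    [sin((n+2)a)]; [chebTSS] is the one for [cos((n+2)a)]. *)
Lemma chebUS x n :
  (chebU R n.+1).[x] = x * (chebU R n).[x] + (chebT R n.+1).[x].
Proof.
elim/nat_ind2: n => [||n IH1 IH2]; [by rewrite !chebE; ring.. |].
have -> : (chebT R n.+3).[x] = 2 * x * ((chebU R n.+2).[x] - x * (chebU R n.+1).[x])
    - ((chebU R n.+1).[x] - x * (chebU R n).[x]).
  by rewrite chebT_rec IH2 IH1; ring.
by rewrite !chebU_rec; ring.
Qed.

Lemma chebTSS x n :
  (chebT R n.+2).[x] =
  x * (chebT R n.+1).[x] + (x ^+ 2 - 1) * (chebU R n).[x].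
Proof.
have e m : (chebT R m.+1).[x] = (chebU R m.+1).[x] - x * (chebU R m).[x].
  by rewrite chebUS addrAC subrr add0r.
by rewrite !e chebU_rec; ring.
Qed.

(** This is [cos^2 + sin^2 = 1] in algebraic form: the step from [n] to [n.+1] given by [chebTSS]
    and [chebUS] preserves the quadratic form. It bounds [T] on [-1, 1] without trigonometry. *)
Lemma cheb_pell x n :
  (chebT R n.+1).[x] ^+ 2 + (1 - x ^+ 2) * (chebU R n).[x] ^+ 2 = 1.
Proof.
elim: n => [|n IH]; first by rewrite !chebE; ring.
by rewrite -[RHS]IH chebTSS chebUS; ring.
Qed.

Lemma chebT_norm_le1 x n : -1 <= x <= 1 -> `|(chebT R n).[x]| <= 1.
Proof.
move=> /andP[x1 x2]; case: n => [|n]; first by rewrite chebT0 normr1.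
rewrite -(ler_pXn2r (n := 2)) ?nnegrE // expr1n real_normK ?num_real //.
rewrite -(cheb_pell x n) lerDl mulr_ge0 ?sqr_ge0 //; nra.
Qed.

(** In [chebUS] the factor [x] does not increase the absolute value and the term [T] adds at most
    1. *)
Lemma chebU_norm_le x n : -1 <= x <= 1 -> `|(chebU R n).[x]| <= n.+1%:R.
Proof.
move=> hx; elim: n => [|n IH]; first by rewrite chebU0 normr1.
rewrite chebUS -natr1 (le_trans (ler_normD _ _))// lerD ?chebT_norm_le1//.
rewrite normrM -[leRHS]mul1r ler_pM// ler_norml //.
Qed.

Lemma chebT_at1 n : (chebT R n).[1] = 1.
Proof. by elim/nat_ind2: n => [||n IH1 IH2]; rewrite !chebE // IH1 IH2; ring. Qed.

Lemma chebT_atN1 n : (chebT R n).[-1] = (-1) ^+ n.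
Proof.
elim/nat_ind2: n => [||n IH1 IH2]; rewrite !chebE ?expr1 // IH1 IH2 !exprS; ring.
Qed.

Lemma chebU_at1 n : (chebU R n).[1] = n.+1%:R.
Proof.
by elim: n => [|n IH]; rewrite ?chebU0// chebUS IH chebT_at1 mul1r natr1.
Qed.

(** The difference of consecutive values grows by [2 * (x - 1) * T_(n+1)(x)], nonnegative once
    [T_(n+1)(x) >= 1], so both bounds go through one induction. *)
Lemma chebT_incr x n : 1 <= x -> 1 <= (chebT R n).[x] <= (chebT R n.+1).[x].
Proof.
move=> x1; elim: n => [|n /andP[IH1 IH2]]; first by rewrite !chebE lexx.
rewrite (le_trans IH1 IH2) /= chebT_rec; nra.
Qed.

Lemma chebT_gt0 x n : 1 <= x -> 0 < (chebT R n).[x].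
Proof. by move=> /(@chebT_incr x n) /andP[/(lt_le_trans ltr01)]. Qed.

Lemma poly_eq0_on_itv (p : {poly R}) (u v : R) :
  u < v -> (forall x, u <= x <= v -> p.[x] = 0) -> p = 0.
Proof.
move=> uv p0; apply/eqP/negPn/negP => pn0.
(* Infinitely many distinct points of the interval; the first [size p] of them are already too many
   roots. *)
pose f (i : nat) := u + (v - u) / i.+1%:R.
have f_inj : injective f.
  move=> i j /addrI /(mulfI _) h; apply/eqP; rewrite -eqSS -(eqr_nat R).
  by apply/eqP/invr_inj/h; rewrite subr_eq0 gt_eqF.
have := max_poly_roots (rs := map f (iota 0 (size p))) pn0.
rewrite map_inj_uniq// iota_uniq size_map size_iota ltnn => h.
suff: false by []; apply: h => //; apply/allP => _ /mapP[i _ ->].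
apply/eqP/p0; rewrite /f lerDl divr_ge0 ?subr_ge0 ?(ltW uv)//=.
rewrite addrC -lerBrDr ler_pdivrMr ?ltr0n// ler_peMr ?subr_ge0 ?(ltW uv)//.
by rewrite ler1n.
Qed.

(** The relation extends from [-1, 1] to all of [R]. At 1 and -1 it forces [b = 0] and [c = - a]; at
    2, outside the interval, [2 T_(n+1) - T_n] is positive, so [a = 0]. *)
Lemma chebT_lin_indep (a b c : R) n :
  (forall x, -1 <= x <= 1 ->
     (a * x + b) * (chebT R n.+1).[x] + c * (chebT R n).[x] = 0) ->
  [/\ a = 0, b = 0 & c = 0].
Proof.
move=> h.
pose p := (a *: 'X + b%:P) * chebT R n.+1 + c *: chebT R n.
have pE x : p.[x] = (a * x + b) * (chebT R n.+1).[x] + c * (chebT R n).[x].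
  by rewrite /p !hornerE.
have p0 : p = 0 by apply: (@poly_eq0_on_itv _ (-1) 1) => [|x hx]; [lra|rewrite pE h].
have h1 := pE 1; have hN1 := pE (-1); have h2 := pE 2.
move: h1 hN1 h2; rewrite p0 !horner0 !chebT_at1 !chebT_atN1 exprS.
move=> h1 hN1 h2.
have s0 : (-1) ^+ n != 0 :> R by rewrite signr_eq0.
have hN1' : a - b + c = 0.
  by apply: (mulIf s0); rewrite mul0r hN1; ring.
have b0 : b = 0 by lra.
have ca : c = - a by lra.
have /andP[] := @chebT_incr 2 n ltac:(lra).
move: h2; rewrite b0 ca addr0 => h2 t1 t2.
suff a0 : a = 0 by split=> //; lra.
have /eqP : a * (2 * (chebT R n.+1).[2] - (chebT R n).[2]) = 0 by rewrite [RHS]h2; ring.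
by rewrite mulf_eq0 => /orP[/eqP//|]; rewrite gt_eqF//; lra.
Qed.

End ChebyshevValues.

(** * Products of companion matrices as scalar recurrences *)

Section CompanionProducts.
Variables (R : realType) (c : two_term R) (lam : R).

Definition state (x y : R) : 'cV[R]_2 := \col_i (if i == 0 then x else y).

Lemma companion_state t x y :
  companion c lam t *m state x y =
  state ((coef_a c t - coef_g c t * lam) * x + coef_b c t * y) x.
Proof.
apply/matrixP => i j; rewrite !mxE !big_ord_recl big_ord0 !mxE /= addr0.
by case: (i == 0) => //; rewrite mul1r mul0r addr0.
Qed.

Lemma e1_state : e1 R = state 1 0.
Proof.
by apply/matrixP => i j; rewrite !mxE ord1 eqxx andbT; case: (i == 0).
Qed.

Lemma e1_mul_state x y : ((e1 R)^T *m state x y) 0 0 = x.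
Proof.
by rewrite !mxE !big_ord_recl big_ord0 !mxE /= mul1r mul0r !addr0.
Qed.

(** Applied to [e1], the product runs the recurrence from time [m] with current value 1 and previous
    value 0. Both factors of the kernel have this form. *)
Lemma companion_prod_rec m n (u : nat -> R) :
    u 0%N = 1 -> ((0 < n)%N -> u 1%N = coef_a c m - coef_g c m * lam) ->
    (forall k, (k.+1 < n)%N ->
       u k.+2 = (coef_a c (m + k.+1) - coef_g c (m + k.+1) * lam) * u k.+1
                + coef_b c (m + k.+1) * u k) ->
  ((e1 R)^T *m companion_prod c lam m (m + n) *m e1 R) 0 0 = u n.
Proof.
move=> u0 u1 uS.
have prodS k : companion_prod c lam m (m + k.+1) =
    companion c lam (m + k) *m companion_prod c lam m (m + k).
  rewrite /companion_prod addnS /index_iota subSn ?leq_addr// addKn.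
  have -> : iota m k.+1 = rcons (iota m k) (m + k) by rewrite -addn1 iotaD cats1.
  by rewrite rev_rcons big_cons.
(* The default 0 is the second entry of [e1], in the place of [u_(-1)]; hence [u 1] carries no
   [coef_b] term. *)
suff h k : (k <= n)%N -> companion_prod c lam m (m + k) *m e1 R =
    state (u k) (if k is k'.+1 then u k' else 0).
  by rewrite -mulmxA h// e1_mul_state.
elim: k => [_|k IH kn].
  by rewrite addn0 /companion_prod /index_iota subnn big_nil mul1mx e1_state u0.
rewrite prodS -mulmxA IH 1?ltnW// companion_state; congr state.
case: k kn {IH} => [|k] kn; last by rewrite uS.
by rewrite addn0 u0 u1// mulr1 mulr0 addr0.
Qed.

End CompanionProducts.

(** * The normalized Chebyshev recurrence and its coefficients *)

Section PrefixExact.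
Variables (R : realType) (mu L : R).
Hypotheses (hmu : 0 < mu) (hL : mu < L).

Notation D := (L - mu).
Notation eta := (eta mu L).
Notation zmap := (zmap mu L).
Notation T t := (chebT R t).[eta].

Let D_gt0 : 0 < D. Proof. by rewrite subr_gt0. Qed.
Let D_neq0 : L - mu != 0. Proof. exact: lt0r_neq0. Qed.
Let S_neq0 : L + mu != 0. Proof. by apply: lt0r_neq0; rewrite addr_gt0 ?(lt_trans hmu hL). Qed.

Lemma eta_gt1 : 1 < eta.
Proof. rewrite /Defs.eta ltr_pdivlMr//; move: hmu hL; lra. Qed.

Lemma chebT_eta_gt0 t : 0 < T t.
Proof. exact/chebT_gt0/ltW/eta_gt1. Qed.

Lemma chebT_eta_neq0 t : T t != 0.
Proof. exact/lt0r_neq0/chebT_eta_gt0. Qed.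

Lemma zmap_mu : zmap mu = 1.
Proof. rewrite /Defs.zmap /Defs.eta; field; exact: D_neq0. Qed.

Lemma zmap_itv lam : mu <= lam <= L -> -1 <= zmap lam <= 1.
Proof.
move=> /andP[l1 l2].
have -> : zmap lam = (L + mu - 2 * lam) / D.
  by rewrite /Defs.zmap /Defs.eta; field; exact: D_neq0.
rewrite ler_pdivlMr// ler_pdivrMr//; move: hmu hL; lra.
Qed.

Lemma zmap_surj z : -1 <= z <= 1 -> exists2 lam, mu <= lam <= L & zmap lam = z.
Proof.
move=> /andP[z1 z2]; exists (D * (eta - z) / 2).
  have -> : D * (eta - z) = L + mu - z * D.
    by rewrite /Defs.eta; field; exact: D_neq0.
  move: hmu hL; nra.
by rewrite /Defs.zmap; field; exact: D_neq0.
Qed.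

Lemma pstar0 lam : pstar mu L 0 lam = 1.
Proof. by rewrite /pstar !chebE divr1. Qed.

Lemma pstar1 lam : pstar mu L 1 lam = 1 - 2 / (L + mu) * lam.
Proof.
rewrite /pstar !chebE /Defs.zmap /Defs.eta; field.
by rewrite D_neq0 S_neq0.
Qed.

(* The initialization has half the weight of the other steps because
   T_1 = z T_0, whereas T_(t+1) = 2 z T_t - T_(t-1). *)
Definition weight t : R := if t == 0%N then 2 else 4.

(** The coefficient of [- lam] after dividing the Chebyshev recurrence by [T t.+1], as [zmap] has
    slope [- 2 / D]. The ratio [T t / T t.+1] cancels against the normalizations of the two other
    kernel factors. *)
Definition gstar t : R := weight t / D * (T t / T t.+1).

Lemma gstar_cheb_rec t : coef_g (cheb_rec mu L) t = gstar t.
Proof.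
rewrite /gstar /weight /=; case: t => [|t] /=.
  rewrite /beta addr0 mul1r !chebE /Defs.eta; field.
  by rewrite D_neq0 S_neq0.
rewrite /beta.
have h := chebT_eta_neq0 t.+2.
have -> : 1 + T t / T t.+2 = 2 * eta * T t.+1 / T t.+2.
  rewrite -[X in X + _](divff h) -mulrDl; congr (_ / _).
  by rewrite chebT_rec; ring.
rewrite [eta in 2 * eta]/Defs.eta; field.
by rewrite D_neq0 S_neq0 h.
Qed.

(** Stated for an arbitrary solution of the three-term recurrence because it serves twice: for [T],
    giving [pstar_rec], and for [U] shifted in time, giving the kernels. *)
Lemma cheb_rec_step t lam v0 v1 v2 :
  v2 = 2 * zmap lam * v1 - v0 ->
  v2 / T t.+2 =
    (1 + beta mu L t.+1 - gstar t.+1 * lam) * (v1 / T t.+1)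
    - beta mu L t.+1 * (v0 / T t).
Proof.
move=> ->.
have h0 := chebT_eta_neq0 t; have h1 := chebT_eta_neq0 t.+1.
have h2 := chebT_eta_neq0 t.+2.
rewrite /gstar /weight /beta /Defs.zmap /=.
have : T t.+2 = 2 * eta * T t.+1 - T t by rewrite chebT_rec.
move: h0 h1 h2; move: (T t) (T t.+1) (T t.+2) => t0 t1 t2 h0 h1 h2 e.
(* Solving the recurrence at [eta] for [eta] leaves a rational identity in free values [t0], [t1],
   [t2]. *)
have -> : eta = (t2 + t0) / (2 * t1) by rewrite e; field.
field.
by rewrite D_neq0 h0 h1 h2.
Qed.

Lemma pstar_rec t lam :
  pstar mu L t.+2 lam =
    (1 + beta mu L t.+1 - gstar t.+1 * lam) * pstar mu L t.+1 lam
    - beta mu L t.+1 * pstar mu L t lam.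
Proof. exact/cheb_rec_step/chebT_rec. Qed.

(** * Residual polynomials and uniqueness of the coefficients *)

Lemma derive1_quad (lam x : R) : derive1 (quad lam) x = lam * x.
Proof.
rewrite derive1E /quad.
have h : is_derive x 1 (fun y : R => 2^-1 * lam * y ^+ 2) (lam * x).
  by apply: is_derive_eq; rewrite /GRing.scale /=; field.
exact: derive_val.
Qed.

(** [residual_polys] constrains only existing trajectories, so one is needed to extract information
    from it. The pair holds the current and previous iterates; the initial dummy 0 is killed by
    [coef_b0]. *)
Lemma trajectory_exists N (c : two_term R) (f : R -> R) (x0 : R) :
  exists2 x, x 0%N = x0 & trajectory N c f x.
Proof.
pose step t (p : R * R) :=
  (coef_a c t * p.1 + coef_b c t * p.2 - coef_g c t * derive1 f p.1, p.1).
exists (fun n => (iteri n step (x0, 0)).1) => //; split=> [|[|t] _] //=.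
by rewrite coef_a0 coef_b0 mul1r mul0r addr0.
Qed.

Lemma prefix_exact_cheb_rec N : prefix_exact N (cheb_rec mu L) mu L.
Proof.
pose r t := (T t)^-1 *: (chebT R t \Po (eta%:P - (2 / D) *: 'X)).
have rE t lam : (r t).[lam] = pstar mu L t lam.
  rewrite hornerZ horner_comp !(hornerD, hornerN, hornerZ, hornerX, hornerC).
  by rewrite /pstar /Defs.zmap mulrC [2 * lam / D]mulrAC.
exists r => // lam x [x1 xS] t; rewrite rE.
elim/nat_ind2: t => [_|_|t IH0 IH1 tN]; first by rewrite pstar0 mul1r.
  by rewrite x1 derive1_quad pstar1 /= addr0; ring.
rewrite xS/=; last lia.
rewrite derive1_quad pstar_rec IH0; last lia.
rewrite IH1; last lia.
by have /= -> := gstar_cheb_rec t.+1; ring.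
Qed.

Lemma prefix_exact_pstar N (c : two_term R) lam :
    prefix_exact N c mu L -> mu <= lam <= L -> (0 < N)%N ->
  pstar mu L 1 lam = 1 - coef_g c 0 * lam /\
  forall t, (t.+1 < N)%N ->
    pstar mu L t.+2 lam =
      (coef_a c t.+1 - coef_g c t.+1 * lam) * pstar mu L t.+1 lam
      + coef_b c t.+1 * pstar mu L t lam.
Proof.
move=> [r rP rE] hlam N0.
have [x x0 xT] := trajectory_exists N c (quad lam) 1.
have xE t : (t <= N)%N -> x t = pstar mu L t lam.
  by move=> tN; rewrite (rP _ _ xT)// x0 mulr1 rE.
have [x1 xS] := xT; split; first by rewrite -xE// x1 x0 derive1_quad mulr1.
move=> t tN; rewrite -!xE; [|lia..].
rewrite xS /=; last lia.
by rewrite derive1_quad; ring.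
Qed.

Lemma prefix_exact_coefs N (c : two_term R) :
    prefix_exact N c mu L ->
  forall t, (t < N)%N ->
    [/\ coef_a c t = 1 + beta mu L t, coef_b c t = - beta mu L t
      & coef_g c t = gstar t].
Proof.
(* At time 0 only [coef_g] is unknown, and comparing the values at the nonzero point [L] determines
   it. *)
move=> pc [N0|t tN].
  have hL' : mu <= L <= L by rewrite ltW/=.
  have [+ _] := prefix_exact_pstar pc hL' N0.
  rewrite pstar1 => h.
  rewrite coef_a0 coef_b0 -gstar_cheb_rec /= addr0 oppr0 mul1r; split=> //.
  have L0 : L != 0 by apply/lt0r_neq0/(lt_trans hmu hL).
  by apply: (mulIf L0); apply/esym; move: h; lra.
have T0 := chebT_eta_neq0 t; have T1 := chebT_eta_neq0 t.+1.
pose A := coef_a c t.+1 - (1 + beta mu L t.+1).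
pose B := coef_b c t.+1 + beta mu L t.+1.
pose G := coef_g c t.+1 - gstar t.+1.
(* With [lam = D * (eta - z) / 2], these are the coefficients of [z T_(t+1)(z)], [T_(t+1)(z)] and
   [T_t(z)] in the difference of the two recurrences for [pstar]. *)
have [] := @chebT_lin_indep R (G * D / 2 / T t.+1)
  ((A - G * D * eta / 2) / T t.+1) (B / T t) t.
  move=> z /zmap_surj[lam hlam <-].
  have [_ /(_ _ tN)] := prefix_exact_pstar pc hlam (ltn_trans (ltn0Sn _) tN).
  rewrite pstar_rec => /eqP; rewrite -subr_eq0 => /eqP h.
  rewrite -[RHS]oppr0 -[in RHS]h /pstar /A /B /G.
  have -> : lam = D * (eta - zmap lam) / 2.
    by rewrite /Defs.zmap; field; exact: D_neq0.
  rewrite [zmap (_ / _)](_ : _ = zmap lam).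
    by field; rewrite T0 T1.
  by rewrite /Defs.zmap; field; exact: D_neq0.
move=> hG hA hB.
have G0 : G = 0.
  apply/eqP; move/eqP: hG; rewrite !mulf_eq0 !invr_eq0 (negPf D_neq0) (negPf T1).
  by rewrite pnatr_eq0 !orbF.
have A0 : A = 0.
  apply/eqP; move/eqP: hA; rewrite G0 !mul0r subr0 mulf_eq0 invr_eq0 (negPf T1).
  by rewrite orbF.
have B0 : B = 0.
  by apply/eqP; move/eqP: hB; rewrite mulf_eq0 invr_eq0 (negPf T0) orbF.
split; first by apply/subr0_eq.
  by apply/eqP; rewrite -addr_eq0; apply/eqP.
exact: subr0_eq.
Qed.

(** * Closed form of the kernels and exact value of the gain *)

Lemma kernelE N (c : two_term R) s lam nu :
    prefix_exact N c mu L -> (s < N)%N ->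
  Defs.kernel N c s lam nu =
    - (weight s / D / T N * (chebU R (N - s.+1)).[zmap lam] * (chebT R s).[zmap nu]).
Proof.
move=> pc sN; have cE := prefix_exact_coefs pc.
rewrite /Defs.kernel -[in companion_prod c lam _ N](subnKC sN).
(* Restarting at time [s.+1] from 1 with previous value 0 matches [U_0 = 1], [U_(-1) = 0]; the
   factor [T s.+1] normalizes the start to 1. *)
rewrite (@companion_prod_rec R c lam s.+1 (N - s.+1)
    (fun k => T s.+1 * ((chebU R k).[zmap lam] / T (s.+1 + k)))); first last.
- move=> k kN; have [-> -> ->] := cE (s.+1 + k.+1)%N ltac:(lia).
  rewrite !addnS (@cheb_rec_step (s.+1 + k) lam (chebU R k).[zmap lam]
    (chebU R k.+1).[zmap lam]) ?chebU_rec//; ring.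
- move=> N0; have [-> _ ->] := cE s.+1 ltac:(lia).
  (* Here 0 and 1 are [U_(-1)] and [U_0]. *)
  rewrite addn1 (@cheb_rec_step s lam 0 1) ?chebE; last by ring.
  by field; rewrite !chebT_eta_neq0.
- by rewrite !chebE addn0 mul1r divff// chebT_eta_neq0.
rewrite subnKC// -[in companion_prod c nu _ s](add0n s).
rewrite (@companion_prod_rec R c nu 0 s (fun k => pstar mu L k nu)); first last.
- move=> k ks; have [-> -> ->] := cE (0 + k.+1)%N ltac:(lia).
  by rewrite add0n pstar_rec mulNr.
- move=> _; have [_ _ ->] := cE 0%N ltac:(lia).
  by rewrite -gstar_cheb_rec coef_a0 pstar1 /= addr0 mul1r.
- exact: pstar0.
have [_ _ ->] := cE s sN; rewrite /gstar /pstar; field.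
by rewrite !chebT_eta_neq0 D_neq0.
Qed.

Lemma weight_sum N : (0 < N)%N ->
  \sum_(s < N) (weight s * (N - s)%:R) ^+ 2 =
  4 * N%:R ^+ 2 + 16 * \sum_(1 <= m < N) m%:R ^+ 2 :> R.
Proof.
case: N => // N _; rewrite big_ord_recl /= subn0 big_add1 big_mkord.
(* The term [s = 0] gives [4 N^2]; for the others, reversal of the index realizes [m = N - s]. *)
rewrite [in RHS](reindex_inj rev_ord_inj)/= mulr_sumr exprMn; congr (_ + _).
  by rewrite /weight eqxx; ring.
apply: eq_bigr => i _; rewrite /weight /= /bump /= exprMn; congr (_ * _ ^+ 2).
  by ring.
by congr (_%:R); have := ltn_ord i; lia.
Qed.

Lemma gain_prefix_exact N (c : two_term R) :
    (0 < N)%N -> prefix_exact N c mu L ->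
  gain N c mu L = eps_star mu L N / D *
    Num.sqrt (4 * N%:R ^+ 2 + 16 * \sum_(1 <= m < N) m%:R ^+ 2).
Proof.
move=> N0 pc; have TN := chebT_eta_gt0 N.
set V := RHS.
have K0 s : 0 <= weight s / D / T N.
  by rewrite !divr_ge0 ?(ltW TN) ?(ltW D_gt0)// /weight; case: ifP.
have VE : V = Num.sqrt (\sum_(s < N) (weight s / D / T N * (N - s)%:R) ^+ 2).
  have -> : \sum_(s < N) (weight s / D / T N * (N - s)%:R) ^+ 2 =
      (1 / T N / D) ^+ 2 * \sum_(s < N) (weight s * (N - s)%:R) ^+ 2.
    rewrite mulr_sumr; apply: eq_bigr => s _.
    by field; rewrite chebT_eta_neq0 D_neq0.
  rewrite weight_sum// sqrtrM ?sqr_ge0// sqrtr_sqr ger0_norm.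
    by rewrite /V /eps_star gtr0_norm.
  by rewrite !divr_ge0 ?ltW.
pose A := [set p : R * R | mu <= p.1 <= L /\ mu <= p.2 <= L].
pose F (p : R * R) := Num.sqrt (\sum_(s < N) `|Defs.kernel N c s p.1 p.2| ^+ 2).
have ubV : ubound [set F p | p in A] V.
  move=> _ [[lam nu] /= [hlam hnu] <-]; rewrite VE ler_wsqrtr// ler_sum// => s _.
  rewrite kernelE// normrN 2!normrM (ger0_norm (K0 s)).
  have KM (x : R) : 0 <= x -> 0 <= weight s / D / T N * x by exact: mulr_ge0.
  rewrite ler_pXn2r ?nnegrE ?KM//; last by rewrite mulr_ge0// KM.
  rewrite -[leRHS]mulr1 ler_pM ?KM// ?chebT_norm_le1 ?zmap_itv//.
  by rewrite ler_wpM2l// -(subnSK (ltn_ord s)) chebU_norm_le// zmap_itv.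
have Amu : A (mu, mu) by rewrite /A /= lexx ltW.
have FV : F (mu, mu) = V.
  rewrite VE; congr Num.sqrt; apply: eq_bigr => s _.
  rewrite kernelE// zmap_mu chebU_at1 chebT_at1 mulr1 normrN.
  by rewrite ger0_norm ?(mulr_ge0 (K0 s))// (subnSK (ltn_ord s)).
have VA : [set F p | p in A] V by exists (mu, mu).
(* [V] is both an upper bound and a member of the set, which supplies the boundedness and
   nonemptiness required of [sup]. *)
apply/le_anti/andP; split; first by apply: ge_sup => //; exists V.
by apply: ub_le_sup => //; exists V.
Qed.

End PrefixExact.

(** * Asymptotics of the lower bound *)

Lemma sum_sqr_nat (R : realFieldType) N :
  6 * \sum_(1 <= m < N.+1) m%:R ^+ 2 =
    N%:R * (N%:R + 1) * (2 * N%:R + 1) :> R.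
Proof.
elim: N => [|N IH]; first by rewrite big_geq// !mulr0 !mul0r.
by rewrite big_nat_recr//= mulrDr IH -natr1; ring.
Qed.

Lemma powR_three_halves (R : realType) N : (0 < N)%N ->
  N%:R `^ (3 / 2) = N%:R * Num.sqrt N%:R :> R.
Proof.
move=> N0; rewrite (_ : 3 / 2 = 1 + 2^-1); last by field.
rewrite powRD ?powRr1 ?powR12_sqrt//.
by rewrite pnatr_eq0 -lt0n N0 implybT.
Qed.

(** The radicand equals [16/3 N^3 - 4 N^2 + 8/3 N], slightly below its leading term; the factor
    [1 - 1/(N+1) = N/(N+1)] absorbs the deficit and keeps the squared inequality rational. *)
Lemma gain_asymptotics (R : realType) N : (0 < N)%N ->
  4 / Num.sqrt 3 * N%:R `^ (3 / 2) * (1 - N.+1%:R^-1) <=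
  Num.sqrt (4 * N%:R ^+ 2 + 16 * \sum_(1 <= m < N) m%:R ^+ 2) :> R.
Proof.
move=> N0; rewrite powR_three_halves//.
have s3 : 0 < Num.sqrt 3 :> R by rewrite sqrtr_gt0.
set l := leLHS.
have l0 : 0 <= l.
  rewrite /l !mulr_ge0 ?sqrtr_ge0 ?invr_ge0 ?subr_ge0//.
  by rewrite invf_le1// ler1n.
rewrite -(ger0_norm l0) -sqrtr_sqr ler_wsqrtr//.
have -> : l ^+ 2 = 16 / 3 * N%:R ^+ 3 * (1 - N.+1%:R^-1) ^+ 2.
  rewrite /l !exprMn exprVn !sqr_sqrtr//; ring.
case: N N0 {l l0} => // N _; have := sum_sqr_nat R N.
have n0 : 0 <= N%:R :> R by [].
have -> : N.+2%:R = N%:R + 2 :> R by rewrite -natrD addn2.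
have -> : N.+1%:R = N%:R + 1 :> R by rewrite natr1.
move: N%:R n0 (\sum_(_ <= _ < _) _) => n n0 S hS.
have -> : 1 - (n + 2)^-1 = (n + 1) / (n + 2) by field; lra.
have -> : 16 * S = 8 / 3 * (6 * S) by field.
rewrite hS expr_div_n mulrA ler_pdivrMr ?exprn_gt0//; last by lra.
rewrite -subr_ge0.
(* Expanded in powers of [n + 1], the difference has only nonnegative coefficients. *)
have -> : (4 * (n + 1) ^+ 2 + 8 / 3 * (n * (n + 1) * (2 * n + 1))) * (n + 2) ^+ 2
  - 16 / 3 * (n + 1) ^+ 3 * (n + 1) ^+ 2
  = 20 / 3 * (n + 1) ^+ 4 + 4 / 3 * (n + 1) ^+ 2 + 8 / 3 * (n + 1) by field.
by rewrite !addr_ge0 ?mulr_ge0 ?exprn_ge0 ?addr_ge0.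
Qed.

Theorem theorem3p1 (R : realType) (mu L : R) (hmu : 0 < mu) (hL : mu < L) :
  [/\ forall (N : nat) (c : two_term R), (1 <= N)%N -> prefix_exact N c mu L ->
        eps_star mu L N / (L - mu) *
          Num.sqrt (4 * N%:R ^+ 2 + 16 * \sum_(1 <= m < N) m%:R ^+ 2)
        <= gain N c mu L,
      forall N : nat, (1 <= N)%N ->
        prefix_exact N (cheb_rec mu L) mu L /\
        gain N (cheb_rec mu L) mu L =
          eps_star mu L N / (L - mu) *
            Num.sqrt (4 * N%:R ^+ 2 + 16 * \sum_(1 <= m < N) m%:R ^+ 2),
      forall N : nat, (1 <= N)%N ->
        prefix_exact N (cheb_rec mu L) mu L /\
        forall c : two_term R, prefix_exact N c mu L ->
          gain N (cheb_rec mu L) mu L <= gain N c mu L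
    & exists o : nat -> R, o @ \oo --> (0 : R) /\
        forall (N : nat) (c : two_term R), (1 <= N)%N -> prefix_exact N c mu L ->
          4 / Num.sqrt 3 * (N%:R `^ (3 / 2) / (L - mu)) * eps_star mu L N
            * (1 - o N) <= gain N c mu L].
Proof.
have chebP := prefix_exact_cheb_rec hmu hL.
have gainE := gain_prefix_exact hmu hL.
split.
- by move=> N c N0 pc; rewrite gainE.
- by move=> N N0; split; rewrite ?gainE.
- by move=> N N0; split=> // c pc; rewrite !gainE.
(* [harmonic N] is [1/(N+1)], the explicit error of [gain_asymptotics]. *)
- exists (@harmonic R); split; first exact: cvg_harmonic.
  move=> N c N0 pc; rewrite gainE//.
  have e0 : 0 <= eps_star mu L N / (L - mu).
    by rewrite /eps_star !divr_ge0 ?subr_ge0 ?(ltW hL).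
  apply: le_trans (ler_wpM2l e0 (gain_asymptotics R N0)).
  by rewrite le_eqVlt; apply/orP; left; apply/eqP; rewrite /harmonic /=; ring.
Qed.
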